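(* Let $(\mathfrak g,[\cdot,\cdot],\alpha)$ be a multiplicative Hom-Lie superalgebra over $\mathbb K$, let $n\ge 2$, let $k\ge 0$ be an integer and let $\mathfrak D:\mathfrak g\to\mathfrak g$ be a homogeneous $\alpha^k$-derivation of $\mathfrak g$. Then $\mathfrak D$ is an $\alpha^k$-derivation of $\mathfrak g_n=(\mathfrak g,[\cdot,\dots,\cdot]_n,\alpha^{n-1})$; that is, $\mathfrak D$ commutes with $\alpha^{n-1}$ and for all homogeneous $x_1,\dots,x_n\in\mathfrak g$ $$\mathfrak D([x_1,\dots,x_n]_n)=\sum_{i=1}^n(-1)^{|\mathfrak D||X|^{i-1}}[\alpha^k(x_1),\dots,\alpha^k(x_{i-1}),\mathfrak D(x_i),\alpha^k(x_{i+1}),\dots,\alpha^k(x_n)]_n,$$ where $|X|^{i-1}=\sum_{l=1}^{i-1}|x_l|$.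
   Context: $\mathbb K$ is an algebraically closed field of characteristic zero. $|v|\in\mathbb Z_2$ denotes the degree of a homogeneous element (or endomorphism) $v$; a map is even if it preserves total degree. $\alpha^k$ is the $k$-fold composition of $\alpha$, $\alpha^0=\mathrm{Id}$. A Hom-Lie superalgebra $(\mathfrak g,[\cdot,\cdot],\alpha)$ is a $\mathbb Z_2$-graded linear space with an even bilinear map $[\cdot,\cdot]$ and an even linear map $\alpha:\mathfrak g\to\mathfrak g$ such that for homogeneous $x,y,z$: $[x,y]=-(-1)^{|x||y|}[y,x]$ and $(-1)^{|x||z|}[\alpha(x),[y,z]]+(-1)^{|y||x|}[\alpha(y),[z,x]]+(-1)^{|z||y|}[\alpha(z),[x,y]]=0$. It is multiplicative if $\alpha([x,y])=[\alpha(x),\alpha(y)]$. The $n$-ary bracket is defined by $[x_1,x_2]_2=[x_1,x_2]$ and $[x_1,\dots,x_m]_m=\big[[x_1,\dots,x_{m-1}]_{m-1},\alpha^{m-2}(x_m)\big]$ for $m\ge 3$. A homogeneous $\mathfrak D\in\mathrm{End}(\mathfrak g)$ is an $\alpha^k$-derivation of $(\mathfrak g,[\cdot,\cdot],\alpha)$ if $\mathfrak D\circ\alpha=\alpha\circ\mathfrak D$ and $\mathfrak D([x,y])=[\mathfrak D(x),\alpha^k(y)]+(-1)^{|\mathfrak D||x|}[\alpha^k(x),\mathfrak D(y)]$ for all homogeneous $x,y$. *)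

(* Defs.v *)
From HB Require Import structures.
From mathcomp Require Import all_boot all_order all_algebra.

Set Implicit Arguments.
Unset Strict Implicit.
Unset Printing Implicit Defensive.

Import GRing.Theory.
Local Open Scope ring_scope.

(* The sign (-1)^a, for a degree a in Z/2; degrees are added and multiplied
   in 'Z_2 before being read as an exponent. *)
Definition gsign (K : fieldType) (a : 'Z_2) : K := (-1) ^+ (a : nat).

(* [homog a x] reads "x is homogeneous of degree a"; the two homogeneous
   components are arbitrary (not necessarily decidable, nor finite-dimensional)
   complementary subspaces. The zero vector is homogeneous of both degrees. *)
Record gradedSpace (K : fieldType) := GradedSpace {
  gcarrier :> lmodType K;
  homog : 'Z_2 -> gcarrier -> Prop;
  homog0 : forall a, homog a 0;
  homogP : forall a (c : K) x y, homog a x -> homog a y -> homog a (c *: x + y);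
  homog_span : forall x, exists x0 x1,
    [/\ homog 0 x0, homog 1 x1 & x = x0 + x1];
  homog_direct : forall x, homog 0 x -> homog 1 x -> x = 0
}.

Definition homog_endo (K : fieldType) (V : gradedSpace K) (d : 'Z_2)
    (f : V -> V) : Prop :=
  forall a x, homog a x -> homog (a + d) (f x).

Record homLieSuperalgebra (K : fieldType) := HomLieSuperalgebra {
  hls_space :> gradedSpace K;
  br : {bilinear hls_space -> hls_space -> hls_space};
  alpha : {linear hls_space -> hls_space};
  br_even : forall a b x y, homog a x -> homog b y -> homog (a + b) (br x y);
  alpha_even : homog_endo 0 alpha;
  br_skew : forall a b x y, homog a x -> homog b y ->
    br x y = - (gsign K (a * b) *: br y x);
  br_jacobi : forall a b c x y z, homog a x -> homog b y -> homog c z ->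
    gsign K (a * c) *: br (alpha x) (br y z)
    + gsign K (b * a) *: br (alpha y) (br z x)
    + gsign K (c * b) *: br (alpha z) (br x y) = 0
}.

Section HomLieSuperalgebraTheory.

Variables (K : fieldType) (g : homLieSuperalgebra K).

Definition multiplicative_hls : Prop :=
  forall x y : g, alpha g (br g x y) = br g (alpha g x) (alpha g y).

(* [alpha_pow k] is the k-th iterate alpha^k. *)
Definition alpha_pow (k : nat) : g -> g := iter k (alpha g).

Definition is_alpha_derivation (k : nat) (d : 'Z_2) (D : g -> g) : Prop :=
  [/\ homog_endo d D,
      forall x, D (alpha g x) = alpha g (D x)
    & forall a b x y, homog a x -> homog b y ->
        D (br g x y) = br g (D x) (alpha_pow k y)
                       + gsign K (d * a) *: br g (alpha_pow k x) (D y)].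

(* The bracket of arity m.+2, indexed from 0: in arity m.+3 the last argument
   is twisted by alpha^(m.+1), i.e. by alpha^(arity - 2). *)
Fixpoint nbr_rec (m : nat) : ('I_m.+2 -> g) -> g :=
  match m with
  | 0 => fun x => br g (x ord0) (x ord_max)
  | m'.+1 => fun x =>
      br g (nbr_rec (fun i : 'I_m'.+2 => x (widen_ord (leqnSn _) i)))
           (alpha_pow m'.+1 (x ord_max))
  end.

(* Arities 0 and 1 get the junk value 0. *)
Definition nbr (n : nat) : ('I_n -> g) -> g :=
  match n with
  | m.+2 => @nbr_rec m
  | _ => fun _ => 0
  end.

(* alpha^k-derivations of the n-ary Hom-superalgebra (g, nbr n, alpha^(n-1)):
   D commutes with the structure map alpha^(n-1) of that algebra, while the
   Leibniz rule is twisted by powers of the original alpha. *)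
Definition is_nary_alpha_derivation (n k : nat) (d : 'Z_2) (D : g -> g)
    : Prop :=
  [/\ homog_endo d D,
      forall x, D (alpha_pow n.-1 x) = alpha_pow n.-1 (D x)
    & forall (a : 'I_n -> 'Z_2) (x : 'I_n -> g),
        (forall i, homog (a i) (x i)) ->
        D (nbr x) =
        \sum_(i < n) gsign K (d * \sum_(l < n | (l < i)%N) a l) *:
          nbr (fun j : 'I_n => if j == i then D (x j) else alpha_pow k (x j))].

End HomLieSuperalgebraTheory.

(* Main.v *)
Require Import Defs.
From HB Require Import structures.
From mathcomp Require Import all_boot all_order all_algebra.

Import GRing.Theory.
Local Open Scope ring_scope.

(** The [n]-ary bracket is a left-nested iterate of the binary one,
    [[x_1, ..., x_n] = [[x_1, ..., x_(n-1)], alpha^(n-2) x_n]], so the [n]-ary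
    Leibniz rule follows by induction on the arity.  Apply the binary rule to
    the outermost bracket.  In the term where [D] hits the inner bracket, the
    induction hypothesis gives the first [n-1] summands; in the other one, the
    sign is governed by the degree of the inner bracket, which is
    [|x_1| + ... + |x_(n-1)|] because bracket and [alpha] are even
    ([homog_nbr_rec]), and [alpha^k] of the inner bracket is the bracket of the
    [alpha^k x_i] because [alpha] is multiplicative ([alpha_pow_nbr_rec]): this
    is the last summand.  In both terms the twist [alpha^(n-2)] has to be moved
    past [alpha^k] or past [D], with which it commutes ([alpha_powC],
    [alpha_pow_comm]). *)

Section AlphaPowers.

Set Implicit Arguments.
Unset Strict Implicit.

Variables (K : fieldType) (g : homLieSuperalgebra K).

Lemma homog_alpha_pow (k : nat) (a : 'Z_2) (x : g) :
  homog a x -> homog a (alpha_pow k x).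
Proof.
move=> ax; elim: k => [//|k IHk].
by rewrite -[a]addr0; apply: alpha_even.
Qed.

Lemma alpha_powC (j k : nat) (x : g) :
  alpha_pow j (alpha_pow k x) = alpha_pow k (alpha_pow j x).
Proof. by rewrite /alpha_pow -!iterD addnC. Qed.

Lemma alpha_pow_comm (D : g -> g) (k : nat) :
  (forall x, D (alpha g x) = alpha g (D x)) ->
  forall x, D (alpha_pow k x) = alpha_pow k (D x).
Proof. by move=> DC x; elim: k => [//|k IHk] /=; rewrite DC IHk. Qed.

Lemma alpha_pow_br (k : nat) (x y : g) : multiplicative_hls g ->
  alpha_pow k (br g x y) = br g (alpha_pow k x) (alpha_pow k y).
Proof. by move=> gM; elim: k => [//|k IHk] /=; rewrite IHk gM. Qed.

End AlphaPowers.

Section NaryBracket.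

Set Implicit Arguments.
Unset Strict Implicit.

Variables (K : fieldType) (g : homLieSuperalgebra K).

Lemma eq_nbr_rec (m : nat) (x y : 'I_m.+2 -> g) :
  x =1 y -> nbr_rec x = nbr_rec y.
Proof.
elim: m x y => [|m IHm] x y xy /=; first by rewrite !xy.
by rewrite xy; congr (br g _ _); apply: IHm => i; rewrite xy.
Qed.

Lemma homog_nbr_rec (m : nat) (a : 'I_m.+2 -> 'Z_2) (x : 'I_m.+2 -> g) :
  (forall i, homog (a i) (x i)) -> homog (\sum_i a i) (nbr_rec x).
Proof.
elim: m a x => [|m IHm] a x ax; rewrite big_ord_recr /=.
  rewrite big_ord1; apply: br_even => //.
  by rewrite (_ : widen_ord _ _ = ord0) //; apply: val_inj.
apply: br_even; last exact: (homog_alpha_pow m.+1).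
by apply: (IHm (fun i => a (widen_ord _ i))) => i; apply: ax.
Qed.

Lemma alpha_pow_nbr_rec (k m : nat) (x : 'I_m.+2 -> g) :
  multiplicative_hls g ->
  alpha_pow k (nbr_rec x) = nbr_rec (fun i => alpha_pow k (x i)).
Proof.
move=> gM; elim: m x => [|m IHm] x; rewrite [LHS]alpha_pow_br //=.
by rewrite IHm; congr (br g _ _); apply: (alpha_powC _ m.+1).
Qed.

(** Splitting off the last index leaves the signs unchanged: the degrees
    preceding a given position are the same in arity [m] and in arity
    [m.+1]. *)
Lemma sum_lt_widen (V : nmodType) (m j : nat) (a : 'I_m.+1 -> V) :
  (j <= m)%N ->
  \sum_(l < m.+1 | (l < j)%N) a l
  = \sum_(l < m | (l < j)%N) a (widen_ord (leqnSn m) l).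
Proof.
move=> le_jm; rewrite big_mkcond big_ord_recr /= ltnNge le_jm addr0.
by rewrite [RHS]big_mkcond.
Qed.

Lemma sum_lt_max (V : nmodType) (m : nat) (a : 'I_m.+1 -> V) :
  \sum_(l < m.+1 | (l < m)%N) a l
  = \sum_(l < m) a (widen_ord (leqnSn m) l).
Proof. by rewrite sum_lt_widen //; apply: eq_bigl => l; rewrite ltn_ord. Qed.

Lemma widen_ord_neq_max (m : nat) (i : 'I_m) :
  (widen_ord (leqnSn m) i == ord_max) = false.
Proof. by rewrite -val_eqE /= ltn_eqF. Qed.

Lemma nbr_rec_leibniz (m k : nat) (d : 'Z_2) (D : g -> g)
    (a : 'I_m.+2 -> 'Z_2) (x : 'I_m.+2 -> g) :
  multiplicative_hls g -> is_alpha_derivation k d D ->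
  (forall i, homog (a i) (x i)) ->
  D (nbr_rec x) =
  \sum_(i < m.+2) gsign K (d * \sum_(l < m.+2 | (l < i)%N) a l) *:
    nbr_rec (fun j => if j == i then D (x j) else alpha_pow k (x j)).
Proof.
move=> gM [_ DC Dbr]; elim: m a x => [|m IHm] a x ax.
  rewrite big_ord_recr big_ord1 /= (Dbr _ _ _ _ (ax ord0) (ax ord_max)).
  rewrite big_pred0 // mulr0 scale1r.
  by rewrite sum_lt_max big_ord1 (_ : widen_ord _ _ = ord0) //; apply: val_inj.
pose w := widen_ord (leqnSn m.+2).
have axw i : homog (a (w i)) (x (w i)) by apply: ax.
have ax_last := homog_alpha_pow m.+1 (ax ord_max).
rewrite [LHS](Dbr _ _ _ _ (homog_nbr_rec axw) ax_last).
rewrite [RHS]big_ord_recr; congr (_ + _).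
  rewrite (IHm _ _ axw) linear_sumlz; apply: eq_bigr => i _.
  rewrite linearZl_LR [in RHS]sum_lt_widen; last exact: ltnW (ltn_ord i).
  congr (_ *: _); rewrite alpha_powC [RHS]/=.
  by rewrite eq_sym widen_ord_neq_max.
rewrite [in RHS]sum_lt_max alpha_pow_nbr_rec // alpha_pow_comm //.
congr (_ *: _); rewrite [RHS]/= eqxx; congr (br g _ _).
by apply: eq_nbr_rec => i; rewrite widen_ord_neq_max.
Qed.

End NaryBracket.

Theorem proposition3p5 (K : closedFieldType) (charK : [pchar K] =i pred0)
    (g : homLieSuperalgebra K) (gM : multiplicative_hls g)
    (n : nat) (n_ge2 : (2 <= n)%N) (k : nat)
    (d : 'Z_2) (D : {linear g -> g}) (derD : is_alpha_derivation k d D) :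
  is_nary_alpha_derivation n k d D.
Proof.
have [Dd DC _] := derD.
split=> // [x|a x ax]; first exact: alpha_pow_comm.
by case: n n_ge2 a x ax => [|[|m]] // _ a x ax; apply: nbr_rec_leibniz.
Qed.
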